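(* Let $a,b\ge 1$ and let $G=\mathcal{K}_{a,b}$ be a complete bipartite graph, with bipartition $V_G=V_1\cup V_2$, $|V_1|=a$, $|V_2|=b$. Let $K$ be a field, and let $h_i=\dim_K A(G)_i$, $i\ge 0$, be the entries of the $h$-vector of the Eulerian Artinian algebra $A(G)$. For $T\subseteq V_G$ write $T_1=T\cap V_1$ and $T_2=T\cap V_2$. Then: (1) $$h_i=\Bigl[\sum_{k\ge 0}\binom{a}{i-2k}\Bigr]\Bigl[\sum_{k\ge 0}\binom{b}{i-2k}\Bigr]-\Bigl[\sum_{k\ge 1}\binom{a}{i-2k}\Bigr]\Bigl[\sum_{k\ge 1}\binom{b}{i-2k}\Bigr].$$ (2) A set $T\subseteq V_G$ of even cardinality is a socle set if and only if, for each $i\in\{1,2\}$, $|T_i|=\max\{|T_1|,|T_2|\}$ implies $T_i=V_i$. In particular, if $a<b$, the socle degrees of $A(G)$ are $a$, with multiplicity $\sum_{i\ge 1}\binom{b}{a-2i}$, and $b$, with multiplicity $\sum_{i\ge 1}\binom{a}{b-2i}$; and if $a=b$, then $A(G)$ is level, of socle degree $a$ and type $2^a-1$.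
   Context: For a finite simple graph $G$ with vertex set $V_G$ and non-empty edge set $E_G$ (each edge a 2-element subset of $V_G$) and any field $K$, $K[E_G]=K[t_e : e\in E_G]$ is the standard graded polynomial ring, with irrelevant ideal $\mathfrak m=(t_e: e\in E_G)$. For $J\subseteq E_G$, $\mathbf{t}_J=\prod_{e\in J}t_e$. $\triangle$ denotes symmetric difference of sets. Binomial coefficients $\binom{m}{k}$ are zero when $k<0$ or $k>m$. For $C\subseteq E_G$ and $v\in V_G$, $\deg_C(v)$ is the number of edges of $C$ containing $v$. $C$ is Eulerian if $\deg_C(v)$ is even for every $v\in V_G$. An Eulerian binomial is $\mathbf{t}_J-\mathbf{t}_L$ where $J,L\subseteq E_G$ are non-empty, $J\cap L=\emptyset$, $|J|=|L|$ and $J\cup L$ is Eulerian. $I(G)$ is the ideal of $K[E_G]$ generated by all Eulerian binomials and all $t_e^2$, $e\in E_G$; $A(G)=K[E_G]/I(G)$ is the Eulerian Artinian algebra of $G$. The socle of $A(G)$ is the graded submodule $\{u\in A(G) : \mathfrak m u=0\}$; its dimension over $K$ is the type of $A(G)$; the socle degrees are the degrees of the elements of a minimal homogeneous generating set (equivalently a homogeneous $K$-basis) of the socle, listed with multiplicity. $A(G)$ is level if its socle is generated in a single degree. For $T\subseteq V_G$, a subset $J\subseteq E_G$ is a $T$-join if $T=\{v\in V_G : \deg_J(v)\text{ is odd}\}$. $\mathcal{T}_G$ is the set of $T\subseteq V_G$ for which a $T$-join exists (for connected $G$, exactly the sets of even cardinality). For bipartite $G$, the parity of the cardinality of a $T$-join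 is determined by $T$, and for $T\in\mathcal{T}_G$, $\tau(T)$ denotes the minimum cardinality of a $T$-join. For bipartite $G$, a set $T\in\mathcal{T}_G$ is a socle set if $\tau(T\triangle e)=\tau(T)-1$ for every $e\in E_G$, where $e$ is regarded as a subset of $V_G$. *)

(* Defs.v *)
From HB Require Import structures.
From mathcomp Require Import all_boot all_order all_algebra.
From mathcomp Require Import generic_quotient ring_quotient boolp.
From mathcomp Require Import mpoly.

Set Implicit Arguments.
Unset Strict Implicit.
Unset Printing Implicit Defensive.

Import GRing.Theory.
Local Open Scope ring_scope.
Local Open Scope quotient_scope.

Record sgraph (V : finType) := SGraph {
  edges : {set {set V}};
  edges_card2 : forall e, e \in edges -> #|e| = 2%N;
  edges_neq0 : edges != set0
}.

Definition complete_bipartite (V : finType) (G : sgraph V) (V1 V2 : {set V}) :=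
  [/\ V1 :|: V2 = [set: V], [disjoint V1 & V2]
    & edges G = [set [set x; y] | x in V1, y in V2]].

Section GraphCombinatorics.

Variables (V : finType) (G : sgraph V).
Implicit Types (C J L e : {set {set V}}) (T : {set V}).

Definition edeg C (v : V) := #|[set e in C | v \in e]|.

Definition eulerian C := [forall v : V, ~~ odd (edeg C v)].

Definition is_join T J :=
  (J \subset edges G) && (T == [set v | odd (edeg J v)]).

Definition join_sets : {set {set V}} := [set T | [exists J, is_join T J]].

(* The default value #|edges G| bounds the size of every T-join, so for T in
   join_sets this is the minimum size; other T are irrelevant. *)
Definition tau T : nat := \big[minn/#|edges G|]_(J | is_join T J) #|J|.

Definition symdiff (A B : {set V}) : {set V} := (A :\: B) :|: (B :\: A).

(* tau (T \triangle e) = tau T - 1, written without truncated subtraction. *)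
Definition socle_set T :=
  T \in join_sets /\
  forall e : {set V}, e \in edges G -> (tau (symdiff T e)).+1 = tau T.

End GraphCombinatorics.

Section IdealSpan.

Variable R : comNzRingType.

Definition ideal_span (X : R -> Prop) (p : R) : Prop :=
  exists s : seq (R * R),
    (forall q, q \in s -> X q.2) /\ p = \sum_(q <- s) q.1 * q.2.

Lemma ideal_span0 X : ideal_span X 0.
Proof. by exists [::]; rewrite big_nil. Qed.

Lemma ideal_spanMD X a p q :
  ideal_span X p -> ideal_span X q -> ideal_span X (a * p + q).
Proof.
move=> [s [Xs ->]] [t [Xt ->]].
exists ([seq (a * u.1, u.2) | u <- s] ++ t); split=> [u|].
  by rewrite mem_cat => /orP[/mapP[w ws ->] /=|]; [apply: Xs | apply: Xt].
rewrite big_cat big_map mulr_sumr; congr (_ + _).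
by apply: eq_bigr => u _; rewrite mulrA.
Qed.

End IdealSpan.

Section Dimension.

Variables (K : fieldType) (M : lmodType K).

Definition is_basis (W : M -> Prop) (d : nat) (b : 'I_d -> M) : Prop :=
  (forall x, W x <-> exists c : 'I_d -> K, x = \sum_i c i *: b i) /\
  (forall c : 'I_d -> K, \sum_i c i *: b i = 0 -> forall i, c i = 0).

Definition has_dim (W : M -> Prop) (d : nat) : Prop :=
  exists b : 'I_d -> M, is_basis W b.

End Dimension.

(* The variable t_e is 'X_i, where i is the rank of e in the enumeration of
   the edges, i.e., e = enum_val i. *)
Notation edge_ring K G := {mpoly K[#|edges G|]}.

Section EulerianAlgebra.

Variables (K : fieldType) (V : finType) (G : sgraph V).

Local Notation R := (edge_ring K G).

Definition tmon (J : {set {set V}}) : R :=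
  \prod_(i < #|edges G| | enum_val i \in J) 'X_i.

Definition eulerian_binomial (p : R) : Prop :=
  exists J L : {set {set V}},
    [/\ [/\ J \subset edges G, L \subset edges G, J != set0 & L != set0],
        [disjoint J & L], #|J| = #|L|, eulerian (J :|: L)
      & p = tmon J - tmon L].

Definition eulerian_gen (p : R) : Prop :=
  eulerian_binomial p \/ exists i : 'I_#|edges G|, p = 'X_i ^+ 2.

Definition eulerian_ideal : pred R := fun p => `[< ideal_span eulerian_gen p >].

Definition irrelevant_ideal (p : R) : Prop :=
  ideal_span (fun q => exists i : 'I_#|edges G|, q = 'X_i) p.

Lemma eulerian_gen_const p : eulerian_gen p -> p.@[fun=> 0] = 0.
Proof.
have tmon0 (J : {set {set V}}) : J \subset edges G -> J != set0 -> (tmon J).@[fun=> 0] = 0.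
  move=> /subsetP JE /set0Pn[e eJ].
  have eE := JE e eJ.
  rewrite /tmon rmorph_prod (bigD1 (enum_rank_in eE e)) /= ?enum_rankK_in //.
  by rewrite mevalXU mul0r.
case=> [[J [L [[JE LE J0 L0] _ _ _ ->]]] | [i ->]].
  by rewrite mevalB !tmon0 // subr0.
by rewrite rmorphXn /= mevalXU expr0n.
Qed.

Lemma eulerian_ideal_closed : idealr_closed eulerian_ideal.
Proof.
split=> [||a p q]; rewrite ?inE /eulerian_ideal.
- exact/asboolP/ideal_span0.
- apply/asboolP => -[s [gs /(congr1 (meval (fun=> 0)))]].
  rewrite meval1 rmorph_sum big1_seq => [/eqP|q /= qs]; first by rewrite oner_eq0.
  by rewrite mevalM (eulerian_gen_const (gs q qs)) mulr0.
by move=> /asboolP Ip /asboolP Iq; apply/asboolP/ideal_spanMD.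
Qed.

HB.instance Definition _ :=
  isIdealr.Build R eulerian_ideal eulerian_ideal_closed.

Definition eulerian_algebra := {ideal_quot (eulerian_ideal : idealr R)}.

Local Notation A := eulerian_algebra.

HB.instance Definition _ := GRing.ComNzRing.on A.
HB.instance Definition _ :=
  EqQuotient.copy A {ideal_quot (eulerian_ideal : idealr R)}.

Definition eulerian_pi (p : R) : A := \pi_A p.

Lemma eulerian_piD p q : eulerian_pi (p + q) = eulerian_pi p + eulerian_pi q.
Proof. by rewrite /eulerian_pi !piE. Qed.

Lemma eulerian_piM p q : eulerian_pi (p * q) = eulerian_pi p * eulerian_pi q.
Proof. by rewrite /eulerian_pi !piE. Qed.

Lemma eulerian_pi1 : eulerian_pi 1 = 1.
Proof. by rewrite /eulerian_pi !piE. Qed.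

Definition eulerian_scale (c : K) (u : A) : A := eulerian_pi c%:MP * u.

Lemma eulerian_scaleA a b u :
  eulerian_scale a (eulerian_scale b u) = eulerian_scale (a * b) u.
Proof. by rewrite /eulerian_scale mulrA -eulerian_piM mpolyCM. Qed.

Lemma eulerian_scale1 : left_id 1 eulerian_scale.
Proof. by move=> u; rewrite /eulerian_scale mpolyC1 eulerian_pi1 mul1r. Qed.

Lemma eulerian_scaleDr : right_distributive eulerian_scale +%R.
Proof. by move=> a u v; rewrite /eulerian_scale mulrDr. Qed.

Lemma eulerian_scaleDl u :
  {morph eulerian_scale^~ u : a b / a + b >-> a + b}.
Proof. by move=> a b; rewrite /eulerian_scale mpolyCD eulerian_piD mulrDl. Qed.

HB.instance Definition _ := GRing.Zmodule_isLmodule.Build K A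
  eulerian_scaleA eulerian_scale1 eulerian_scaleDr eulerian_scaleDl.

Definition homog_part (d : nat) (u : A) : Prop :=
  exists p : R, p \is d.-homog /\ u = eulerian_pi p.

Definition socle (u : A) : Prop :=
  forall p : R, irrelevant_ideal p -> eulerian_pi p * u = 0.

(* The sequence s lists the degrees of some homogeneous K-basis of the socle;
   it is determined by this up to permutation. *)
Definition socle_degrees (s : seq nat) : Prop :=
  exists b : 'I_(size s) -> A,
    is_basis socle b /\ forall i : 'I_(size s), homog_part (nth 0%N s i) (b i).

Definition is_type (r : nat) : Prop := has_dim socle r.

Definition level : Prop :=
  exists d, forall u, socle u ->
    ideal_span (fun v => socle v /\ homog_part d v) u.

End EulerianAlgebra.

(* Main.v *)
Require Import Defs.
From HB Require Import structures.
From mathcomp Require Import all_boot all_order all_algebra.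
From mathcomp Require Import generic_quotient ring_quotient boolp mpoly.
From mathcomp Require Import zify.

(* Over any bipartite graph, fix a minimal T-join J_T for each T having a
   T-join.  The classes of the monomials t_(J_T) form a basis of A(G), graded by
   tau.  They span: two T-joins of the same size differ by an Eulerian binomial,
   while a T-join S that is not minimal is congruent to a monomial divisible by
   some t_e^2 (compare S with a minimal L: by parity |S \triangle L| is even,
   and S \ L contains more than half of it, so half of S \triangle L can be
   exchanged inside S for the other half, which meets S).  They are independent:
   summing the coefficients of a polynomial over the minimal T-joins defines a
   linear form vanishing on I(G).  Multiplication by t_e sends the class of T to
   that of T \triangle e or to 0, according to whether tau increases, so the
   classes of the socle sets form a basis of the socle.  In the complete
   bipartite graph, tau T = max(|T_1|, |T_2|), and counting finishes. *)

Set Implicit Arguments.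
Unset Strict Implicit.
Unset Printing Implicit Defensive.

(** * Symmetric differences and T-joins *)

Section SymmetricDifference.

Variable T : finType.
Implicit Types (A B C : {set T}) (x : T).

Lemma in_symdiff A B x : (x \in symdiff A B) = (x \in A) (+) (x \in B).
Proof. by rewrite !inE; case: (x \in A); case: (x \in B). Qed.

Lemma symdiffC : commutative (@symdiff T).
Proof. by move=> A B; apply/setP=> x; rewrite !in_symdiff addbC. Qed.

Lemma symdiff0 A : symdiff A set0 = A.
Proof. by apply/setP=> x; rewrite in_symdiff inE addbF. Qed.

Lemma symdiffK A B : symdiff (symdiff A B) B = A.
Proof. by apply/setP=> x; rewrite !in_symdiff -addbA addbb addbF. Qed.

Lemma card_symdiff A B : #|symdiff A B| + 2 * #|A :&: B| = #|A| + #|B|.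
Proof.
have [e1 e2] := (cardsID B A, cardsID A B).
have -> : #|symdiff A B| = #|A :\: B| + #|B :\: A|.
  apply/eqP; rewrite /symdiff leq_card_setU disjoints_subset.
  by apply/subsetP=> x; rewrite !inE => /andP[/negPf-> ->].
by rewrite setIC in e2; lia.
Qed.

Lemma symdiff_disjoint A B : [disjoint A & B] -> symdiff A B = A :|: B.
Proof.
move=> dAB; apply/setP=> x; rewrite in_symdiff inE.
by case: (boolP (x \in A)) => // /(disjointFr dAB) ->.
Qed.

Lemma symdiff_sub A B C : A \subset C -> B \subset C -> symdiff A B \subset C.
Proof. by move=> sA sB; rewrite subUset !subDset !subsetU ?sA ?sB ?orbT. Qed.

End SymmetricDifference.

(** * T-joins, their boundaries and their minimal size *)

Section TJoins.

Variables (V : finType) (G : sgraph V).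
Implicit Types (J L : {set {set V}}) (T e : {set V}).

(** The mod 2 boundary map of the graph: T-joins are the edge sets with boundary T, and Eulerian
    sets are its kernel. *)
Definition boundary J : {set V} := [set v | odd (edeg J v)].

Lemma boundary_symdiff J L :
  boundary (symdiff J L) = symdiff (boundary J) (boundary L).
Proof.
apply/setP=> v; rewrite in_symdiff !inE /edeg.
have := card_symdiff [set e in J | v \in e] [set e in L | v \in e].
have -> : symdiff [set e in J | v \in e] [set e in L | v \in e]
          = [set e in symdiff J L | v \in e].
  apply/setP=> e; rewrite in_symdiff !inE.
  by case: (v \in e); rewrite !(andbT, andbF) // -in_symdiff !inE.
by rewrite -oddD => <-; rewrite oddD mul2n odd_double addbF.
Qed.

Lemma boundary_set1 e : boundary [set e] = e.
Proof.
apply/setP=> v; rewrite inE /edeg.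
have -> : [set e' in [set e] | v \in e'] = if v \in e then [set e] else set0.
  apply/setP=> e'; rewrite !inE; case: (eqVneq e' e) => [->|ne] /=.
    by case: (v \in e); rewrite ?inE ?eqxx.
  by case: (v \in e); rewrite ?inE ?(negPf ne).
by case: (v \in e); rewrite ?cards1 ?cards0.
Qed.

Lemma boundary0 : boundary set0 = set0.
Proof.
by apply/setP=> v; rewrite !inE /edeg (_ : [set _ in _ | _] = set0) ?cards0 //;
  apply/setP=> e; rewrite !inE.
Qed.

Lemma eulerianE J : eulerian J = (boundary J == set0).
Proof.
apply/forallP/eqP => [ev|bJ v]; first by apply/setP=> v; rewrite !inE (negPf (ev v)).
by have := in_set0 v; rewrite -bJ inE => ->.
Qed.

Lemma is_joinE T J : is_join G T J = (J \subset edges G) && (T == boundary J).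
Proof. by []. Qed.

Lemma tau_le T J : is_join G T J -> tau G T <= #|J|.
Proof.
move=> jJ; rewrite /tau.
have: J \in index_enum {set {set V}} by rewrite mem_index_enum.
elim: (index_enum _) => //= L s IH.
rewrite inE big_cons => /predU1P[<-|/IH le]; first by rewrite jJ geq_minl.
by case: ifP => // _; apply: leq_trans (geq_minr _ _) le.
Qed.

Lemma tau_attained T J : is_join G T J ->
  exists2 L, is_join G T L & #|L| = tau G T.
Proof.
move=> jJ; have: tau G T = #|edges G| \/
    exists2 L, is_join G T L & #|L| = tau G T.
  rewrite /tau; elim/big_rec: _ => [|L t jL [->|[L' jL' <-]]]; first by left.
    by right; exists L => //; apply/esym/minn_idPl/subset_leq_card; case/andP: jL.
  by right; case: (leqP #|L| #|L'|) => _; [exists L | exists L'].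
(* If the fold returned its default value [#|edges G|], no T-join is smaller than that, and J itself
   attains it. *)
case=> // tE; exists J => //; apply/eqP; rewrite eqn_leq (tau_le jJ) andbT tE.
by apply: subset_leq_card; case/andP: jJ.
Qed.

Lemma is_join_symdiff T U J L : is_join G T J -> is_join G U L ->
  is_join G (symdiff T U) (symdiff J L).
Proof.
rewrite !is_joinE => /andP[JE /eqP ->] /andP[LE /eqP ->].
by rewrite symdiff_sub // boundary_symdiff eqxx.
Qed.

Lemma is_join_edge e : e \in edges G -> is_join G e [set e].
Proof. by move=> eE; rewrite is_joinE sub1set eE boundary_set1 eqxx. Qed.

Lemma is_join_boundary J : J \subset edges G -> is_join G (boundary J) J.
Proof. by move=> JE; rewrite is_joinE JE eqxx. Qed.

Definition bipartition (W : {set V}) := forall e, e \in edges G -> #|e :&: W| = 1.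

(** Each edge of J is counted once at its endpoint in W, so |J| is the sum of the degrees over W,
    and modulo 2 only the vertices of T contribute. The induction removes one edge at a time. *)
Lemma odd_card_join (W : {set V}) T J : bipartition W -> is_join G T J ->
  odd #|J| = odd #|T :&: W|.
Proof.
move=> bW; rewrite is_joinE => /andP[JE /eqP->].
elim: {J}_.+1 {-2}J (ltnSn #|J|) JE => // n IH J leJ JE.
have [->|[e eJ]] := set_0Vmem J; first by rewrite boundary0 set0I !cards0.
have JE' : J :\ e \subset edges G by apply: subset_trans JE; apply: subD1set.
have JD : symdiff (J :\ e) [set e] = J.
  by apply/setP=> f; rewrite in_symdiff !inE; case: eqVneq => [->|]; rewrite ?eJ ?addbF.
have cJ : #|J| = #|J :\ e|.+1 by rewrite (cardsD1 e) eJ.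
have bI A B : symdiff A B :&: W = symdiff (A :&: W) (B :&: W).
  by apply/setP=> x; rewrite !(in_symdiff, inE) andb_addl.
have := card_symdiff (boundary (J :\ e) :&: W) (e :&: W).
rewrite (bW _ (subsetP JE _ eJ)) -bI -[X in symdiff _ X](boundary_set1 e) -boundary_symdiff JD.
by have := IH (J :\ e) ltac:(lia) JE'; lia.
Qed.

End TJoins.

(** * Coefficients on minimal T-joins *)

Section SquarefreeMonomials.
Import GRing.Theory.
Local Open Scope ring_scope.
Variables (K : fieldType) (V : finType) (G : sgraph V).
Implicit Types (J L S : {set {set V}}) (T e : {set V}).
Local Notation n := #|edges G|.

Definition set_mnm J : 'X_{1..n} := [multinom (enum_val i \in J : nat) | i < n].

Lemma tmonE J : tmon K G J = 'X_[set_mnm J].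
Proof.
rewrite mpolyXE_id /tmon big_mkcond; apply: eq_bigr => i _.
by rewrite mnmE; case: (_ \in J).
Qed.

Lemma mdeg_set_mnm J : J \subset edges G -> mdeg (set_mnm J) = #|J|.
Proof.
move=> JE; transitivity (\sum_(i < n) (enum_val i \in J : nat))%N.
  by rewrite mdegE; apply: eq_bigr => i _; rewrite mnmE.
rewrite -(big_enum_val (fun e => (e \in J : nat))) -sum1_card -{2}(setIidPr JE).
rewrite big_mkcond [RHS]big_mkcond; apply: eq_bigr => e _; rewrite inE.
by case: (e \in edges G); case: (e \in J).
Qed.

Lemma set_mnm_inj J L : J \subset edges G -> L \subset edges G ->
  set_mnm J = set_mnm L -> J = L.
Proof.
move=> JE LE /mnmP eqJL; apply/setP=> e.
case: (boolP (e \in edges G)) => [eE|eE]; last first.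
  by rewrite (contraNF (subsetP JE e) eE) (contraNF (subsetP LE e) eE).
have := eqJL (enum_rank_in eE e); rewrite !mnmE enum_rankK_in //.
by case: (e \in J); case: (e \in L).
Qed.

Lemma set_mnmU J L : [disjoint J & L] ->
  set_mnm (J :|: L) = (set_mnm J + set_mnm L)%MM.
Proof.
move=> dJL; apply/mnmP => i; rewrite mnmDE !mnmE inE.
by case: (boolP (_ \in J)) => // /(disjointFr dJL) ->.
Qed.

(** Splits the monomials into those divisible by some t_e^2, which vanish in A(G), and the
    squarefree ones t_S. *)
Lemma mnm_squarefree (m : 'X_{1..n}) :
  {i | (1 < m i)%N} + {S : {set {set V}} | S \subset edges G & m = set_mnm S}.
Proof.
case: (pickP (fun i => (1 < m i)%N)) => [i lt|le]; first by left; exists i.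
right; exists [set enum_val i | i in [set i : 'I_n | m i != 0%N]].
  by apply/subsetP=> _ /imsetP[i _ ->]; apply: enum_valP.
apply/mnmP => i; rewrite mnmE mem_imset ?inE; last exact: enum_val_inj.
by have := le i; case: (m i) => [|[]].
Qed.

Lemma tmonU J L : [disjoint J & L] -> tmon K G (J :|: L) = tmon K G J * tmon K G L.
Proof. by move=> dJL; rewrite !tmonE set_mnmU // mpolyXD. Qed.

Lemma tmon_set1 e (eE : e \in edges G) : tmon K G [set e] = 'X_(enum_rank_in eE e).
Proof.
rewrite tmonE; congr 'X_[_]; apply/mnmP => i; rewrite mnmE mnm1E inE.
by rewrite -(inj_eq enum_val_inj) enum_rankK_in // eq_sym.
Qed.

End SquarefreeMonomials.

(** * Linear forms vanishing on the Eulerian ideal *)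

Section MinimalJoinCoefficients.
Import GRing.Theory.
Local Open Scope ring_scope.
Variables (K : fieldType) (V : finType) (G : sgraph V).
Implicit Types (J L S : {set {set V}}) (T e : {set V}) (p q : edge_ring K G).
Local Notation n := #|edges G|.

Definition min_join T J := is_join G T J && (#|J| == tau G T).

(** Since J and L have the same boundary, [symdiff S L] is also a T-join. Its size is |S| + |L| -
    2|S \cap L|, while tau T = |S| + |J| = |S| + |L|, so minimality forces S and L to be
    disjoint. *)
Lemma min_joinU_swap T S J L :
    S \subset edges G -> L \subset edges G ->
    #|J| = #|L| -> boundary J = boundary L ->
    [disjoint S & J] -> min_join T (S :|: J) ->
  [disjoint S & L] /\ min_join T (S :|: L).
Proof.
move=> SE LE cJL bJL dSJ /andP[jSJ /eqP cSJ].
have jSL : is_join G T (symdiff S L).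
  move: jSJ; rewrite !is_joinE => /andP[_ /eqP->].
  by rewrite symdiff_sub // -symdiff_disjoint // !boundary_symdiff bJL eqxx.
have := card_symdiff S L; have := card_symdiff S J; have := tau_le jSL.
rewrite (symdiff_disjoint dSJ) (disjoint_setI0 dSJ) cards0.
move=> le cJ cL; have dSL : [disjoint S & L] by rewrite -setI_eq0 -cards_eq0; lia.
rewrite dSL /min_join -symdiff_disjoint // jSL; split=> //; apply/eqP.
by move: cL; rewrite (disjoint_setI0 dSL) cards0; lia.
Qed.

(** This is the coordinate of the class of p along T, as [eulerian_pi_span] shows. *)
Definition join_coef p T : K := \sum_(J | min_join T J) p@_(set_mnm G J).

Lemma join_coef0 T : join_coef 0 T = 0.
Proof. by rewrite /join_coef big1 // => J _; rewrite mcoeff0. Qed.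

Lemma join_coefD p q T : join_coef (p + q) T = join_coef p T + join_coef q T.
Proof. by rewrite -big_split; apply: eq_bigr => J _; rewrite mcoeffD. Qed.

Lemma join_coefZ c p T : join_coef (c *: p) T = c * join_coef p T.
Proof. by rewrite [RHS]mulr_sumr; apply: eq_bigr => J _; rewrite mcoeffZ. Qed.

Lemma join_coefX S T : S \subset edges G ->
  join_coef 'X_[set_mnm G S] T = (min_join T S)%:R.
Proof.
move=> SE; rewrite /join_coef.
have SJ J : min_join T J -> ('X_[set_mnm G S] : edge_ring K G)@_(set_mnm G J) = (J == S)%:R.
  move=> /andP[/andP[JE _] _]; rewrite mcoeffX; congr ((nat_of_bool _)%:R).
  by apply/eqP/eqP => [|->//]; move/(set_mnm_inj SE JE).
rewrite (eq_bigr _ SJ); case: (boolP (min_join T S)) => mS.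
  by rewrite (bigD1 S) //= eqxx big1 ?addr0 // => J /andP[_ /negPf->].
by rewrite big1 // => J mJ; case: eqP mJ => // -> ; rewrite (negPf mS).
Qed.

Lemma join_coefX_nsq (m : 'X_{1..n}) i T : (1 < m i)%N -> join_coef 'X_[m] T = 0.
Proof.
move=> lt; rewrite /join_coef big1 // => J _; rewrite mcoeffX.
by case: eqP lt => // ->; rewrite mnmE; case: (_ \in J).
Qed.

(** The value is phrased as the existence of a complement S so that the two terms of an Eulerian
    binomial can be compared with the same S. *)
Lemma join_coef_tmonM (m : 'X_{1..n}) J T : J \subset edges G ->
  join_coef ('X_[m] * tmon K G J) T
    = [exists S : {set {set V}}, [&& S \subset edges G, m == set_mnm G S,
                        [disjoint S & J] & min_join T (S :|: J)]]%:R.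
Proof.
move=> JE; rewrite tmonE -mpolyXD.
have [[i lt]|[S SE ->]] := mnm_squarefree m.
  rewrite (@join_coefX_nsq _ i) ?mnmDE ?ltn_addr //.
  case: existsP => // -[S /and4P[_ /eqP mS _ _]].
  by move: lt; rewrite mS mnmE; case: (_ \in S).
case: (boolP [disjoint S & J]) => [dSJ|ndSJ].
  rewrite -set_mnmU // join_coefX ?subUset ?SE //; congr ((nat_of_bool _)%:R).
  apply/idP/existsP => [mT|[S' /and4P[S'E /eqP /set_mnm_inj <- //]]].
  by exists S; rewrite SE eqxx dSJ.
(* An edge common to S and J makes the product divisible by its square. *)
rewrite -setI_eq0 in ndSJ; have [e] := set0Pn _ ndSJ.
rewrite inE => /andP[eS eJ]; have eE := subsetP SE _ eS.
rewrite (@join_coefX_nsq _ (enum_rank_in eE e)); last first.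
  by rewrite mnmDE !mnmE enum_rankK_in // eS eJ.
case: existsP => // -[S' /and4P[S'E /eqP /set_mnm_inj eqS]].
by rewrite -eqS // -setI_eq0 (negPf ndSJ).
Qed.

(** By linearity p is a monomial. A multiple of t_e^2 contains no squarefree monomial, and for a
    binomial t_J - t_L the exchange lemma shows that both terms contribute equally. *)
Lemma join_coef_genM q p T : eulerian_gen q -> join_coef (p * q) T = 0.
Proof.
move=> gq; elim/mpolyind: p => [|c m p _ _ IH]; first by rewrite mul0r join_coef0.
rewrite mulrDl join_coefD {}IH addr0 -scalerAl join_coefZ; apply/eqP.
rewrite mulf_eq0; apply/orP; right; apply/eqP.
case: gq => [[J [L [[JE LE _ _] dJL cJL eJL ->]]]|[i ->]]; last first.
  rewrite mpolyXn -mpolyXD (@join_coefX_nsq _ i) // mnmDE mulmnE mnm1E eqxx.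
  by rewrite mul1n addn2.
(* J and L are disjoint, so their union is their symmetric difference, and its boundary vanishes
   exactly when theirs agree. *)
have bJL : boundary J = boundary L.
  move: eJL; rewrite eulerianE -symdiff_disjoint // boundary_symdiff => /eqP b0.
  by rewrite -[LHS](symdiffK _ (boundary L)) b0 symdiffC symdiff0.
rewrite mulrBr -scaleN1r join_coefD join_coefZ mulN1r !join_coef_tmonM //.
apply/eqP; rewrite subr_eq0; apply/eqP; congr ((nat_of_bool _)%:R).
apply/existsP/existsP => -[S /and4P[SE mS dS mT]]; exists S; rewrite SE mS /=.
  by have [-> ->] := min_joinU_swap SE LE cJL bJL dS mT.
by have [-> ->] := min_joinU_swap SE JE (esym cJL) (esym bJL) dS mT.
Qed.

Lemma join_coef_ideal p T : ideal_span (@eulerian_gen K V G) p -> join_coef p T = 0.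
Proof.
case=> s [gs ->]; elim: s gs => [|q s IH] gs; first by rewrite big_nil join_coef0.
rewrite big_cons join_coefD IH ?addr0 => [|r rs]; last by apply: gs; rewrite inE rs orbT.
by apply: join_coef_genM; apply: gs; rewrite inE eqxx.
Qed.

End MinimalJoinCoefficients.

(** * Monomials modulo the Eulerian ideal *)

Lemma exists_subset_card (T : finType) (A : {set T}) k : k <= #|A| ->
  exists2 B : {set T}, B \subset A & #|B| = k.
Proof.
move=> le; have /card_gt0P[B] : 0 < #|[set B : {set T} | B \subset A & #|B| == k]|.
  by rewrite cards_draws bin_gt0.
by rewrite inE => /andP[BA /eqP cB]; exists B.
Qed.

Section Classes.
Import GRing.Theory.
Local Open Scope ring_scope.
Variables (K : fieldType) (V : finType) (G : sgraph V).
Implicit Types (J L S : {set {set V}}) (T e : {set V}) (p q : edge_ring K G).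
Local Notation n := #|edges G|.
Local Notation A := (eulerian_algebra K G).
Local Notation pi := (@eulerian_pi K V G).
Local Notation t := (tmon K G).

Lemma eulerian_pi_eq0 p : pi p = 0 <-> ideal_span (@eulerian_gen K V G) p.
Proof.
have pi0 : pi 0 = 0 by apply: (addrI (pi 0)); rewrite -eulerian_piD !addr0.
rewrite -pi0 -[p in X in _ <-> X]subr0; split=> [|Ip].
  by move=> /eqP; rewrite /eulerian_pi -Quotient.idealrBE => /asboolP.
by apply/eqP; rewrite /eulerian_pi -Quotient.idealrBE; apply/asboolP.
Qed.

Lemma eulerian_pi0 : pi 0 = 0.
Proof. exact/eulerian_pi_eq0/ideal_span0. Qed.

Lemma eulerian_piZ c p : pi (c *: p) = c *: pi p.
Proof. by rewrite -mul_mpolyC eulerian_piM. Qed.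

Lemma eulerian_pi_gen p : eulerian_gen p -> pi p = 0.
Proof.
move=> gp; apply/eulerian_pi_eq0; exists [:: (1, p)].
by rewrite big_seq1 mul1r; split=> // q; rewrite inE => /eqP->.
Qed.

Lemma eulerian_piXn2 i : pi ('X_i ^+ 2) = 0.
Proof. by apply: eulerian_pi_gen; right; exists i. Qed.

Lemma eulerian_pi_surj (u : A) : exists p, u = pi p.
Proof. by exists (repr u); rewrite /eulerian_pi reprK. Qed.

Lemma eulerian_piX_nsq (m : 'X_{1..n}) i : (1 < m i)%N -> pi 'X_[m] = 0.
Proof.
move=> lt; rewrite -(submK (_ : U_(i) *+ 2 <= m)%MM); last first.
  apply/mnm_lepP => j; rewrite mulmnE mnm1E; case: eqP => [<-|_] //; exact: lt.
by rewrite mpolyXD eulerian_piM -mpolyXn eulerian_piXn2 mulr0.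
Qed.

Lemma eulerian_pi_tmonM_eq0 J L e : e \in edges G -> e \in J -> e \in L ->
  pi (t J) * pi (t L) = 0.
Proof.
move=> eE eJ eL; rewrite -eulerian_piM !tmonE -mpolyXD.
rewrite (@eulerian_piX_nsq _ (enum_rank_in eE e)) // mnmDE !mnmE enum_rankK_in //.
by rewrite eJ eL.
Qed.

Lemma eulerian_pi_tmonID J L : pi (t J) = pi (t (J :&: L)) * pi (t (J :\: L)).
Proof.
rewrite -{1}(setID J L) tmonU ?eulerian_piM // -setI_eq0.
by apply/eqP/setP=> e; rewrite !inE; case: (e \in J); case: (e \in L).
Qed.

Lemma eulerian_pi_tmon_disjoint J L : J \subset edges G -> L \subset edges G ->
  [disjoint J & L] -> #|J| = #|L| -> boundary (J :|: L) = set0 ->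
  pi (t J) = pi (t L).
Proof.
(* Eulerian binomials exclude empty sets; if J is empty, so is L. *)
move=> JE LE dJL cJL b0; case: (eqVneq J set0) => [J0|J0].
  by move/eqP: cJL; rewrite J0 cards0 eq_sym cards_eq0 => /eqP->.
have L0 : L != set0 by rewrite -card_gt0 -cJL card_gt0.
rewrite -[t J](subrK (t L)) eulerian_piD eulerian_pi_gen ?add0r //.
by left; exists J, L; split; rewrite ?eulerianE ?b0.
Qed.

(** After the common factor t_(J \cap L) is taken out, the remaining sets are disjoint, of equal
    size, and their union is Eulerian. *)
Lemma eulerian_pi_tmon_join T J L : is_join G T J -> is_join G T L ->
  #|J| = #|L| -> pi (t J) = pi (t L).
Proof.
rewrite !is_joinE => /andP[JE /eqP bJ] /andP[LE /eqP bL] cJL.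
rewrite (eulerian_pi_tmonID J L) (eulerian_pi_tmonID L J) (setIC L J).
congr (_ * _); apply: eulerian_pi_tmon_disjoint.
- exact: subset_trans (subsetDl _ _) JE.
- exact: subset_trans (subsetDl _ _) LE.
- by apply/pred0P=> e; rewrite !inE; case: (e \in J); case: (e \in L).
- by have := cardsID L J; have := cardsID J L; rewrite (setIC L J); lia.
by rewrite boundary_symdiff -bJ -bL -[RHS](symdiffK set0 T) (symdiffC set0) symdiff0.
Qed.

Variable W : {set V}.
Hypothesis bipW : bipartition G W.

Lemma eulerian_pi_tmon_nonmin T S :
  is_join G T S -> #|S| != tau G T -> pi (t S) = 0.
Proof.
move=> jS nmin; have [L jL cL] := tau_attained jS.
have ltLS : (#|L| < #|S|)%N by have := tau_le jS; lia.
have oSL : odd #|S| = odd #|L|.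
  by rewrite (odd_card_join bipW jS) (odd_card_join bipW jL).
have := is_join_symdiff jS jL; set D := symdiff S L.
rewrite is_joinE => /andP[DE /eqP bD].
have cD := card_symdiff S L; rewrite -/D in cD.
have cSL := cardsID L S.
(* |D| is even by [oSL], and S \ L holds more than half of D because |S| > |L|. *)
have [J' J'S cJ'] := @exists_subset_card _ (S :\: L) #|D|./2 ltac:(lia).
have SD : S :\: L \subset D by apply: subsetUl.
have J'D := subset_trans J'S SD.
have J'S' : J' \subset S := subset_trans J'S (subsetDl _ _).
rewrite (eulerian_pi_tmonID S J') (setIidPr J'S').
have -> : pi (t J') = pi (t (D :\: J')).
  apply: eulerian_pi_tmon_disjoint.
  - exact: subset_trans J'D DE.
  - exact: subset_trans (subsetDl _ _) DE.
  - by rewrite disjoints_subset; apply/subsetP=> e eJ'; rewrite !inE eJ'.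
  - by rewrite cardsDS //; lia.
  rewrite (_ : _ :|: _ = D); last first.
    by rewrite -{1}(setIidPr J'D) setID.
  by rewrite -bD -[RHS](symdiffK set0 T) (symdiffC set0) symdiff0.
(* The majority is strict, so some edge of S \ L lies outside J'; it divides both t_(S \ J') and the
   new factor t_(D \ J'). *)
have /card_gt0P[e] : (0 < #|(S :\: L) :\: J'|)%N by rewrite cardsDS //; lia.
rewrite !inE => /and3P[eJ' eL eS].
have eE : e \in edges G by move: jS => /andP[/subsetP->].
by apply: (eulerian_pi_tmonM_eq0 eE); rewrite !inE ?eJ' ?eL ?eS.
Qed.

End Classes.

(** * The basis of classes of minimal T-joins *)

Section JoinClasses.
Import GRing.Theory.
Local Open Scope ring_scope.
Variables (K : fieldType) (V : finType) (G : sgraph V) (W : {set V}).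
Hypothesis bipW : bipartition G W.
Implicit Types (J L S : {set {set V}}) (T e : {set V}) (p q : edge_ring K G).
Local Notation A := (eulerian_algebra K G).
Local Notation pi := (@eulerian_pi K V G).
Local Notation t := (tmon K G).

Lemma join_setsP T : reflect (exists J, is_join G T J) (T \in join_sets G).
Proof. by rewrite inE; apply: existsP. Qed.

Lemma join_sets_min T : T \in join_sets G -> exists J, min_join G T J.
Proof.
case/join_setsP=> J /tau_attained[L jL cL].
by exists L; rewrite /min_join jL cL eqxx.
Qed.

(** The default 0 for T without a T-join allows sums over all subsets of V. *)
Definition join_poly T : edge_ring K G :=
  if [pick J | min_join G T J] is Some J then t J else 0.

Definition join_class T : A := pi (join_poly T).

Lemma join_polyP T : T \in join_sets G ->
  exists2 J, min_join G T J & join_poly T = t J.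
Proof.
move=> /join_sets_min[L mL]; rewrite /join_poly.
by case: pickP => [J mJ|/(_ L)]; [exists J | rewrite mL].
Qed.

Lemma join_poly_notin T : T \notin join_sets G -> join_poly T = 0.
Proof.
move=> nT; rewrite /join_poly; case: pickP => // J /andP[jJ _].
by case/join_setsP: nT; exists J.
Qed.

Lemma join_poly_homog T : join_poly T \is (tau G T).-homog.
Proof.
case: (boolP (T \in join_sets G)) =>
  [/join_polyP[J mJ ->]|/join_poly_notin ->]; last exact: dhomog0.
case/andP: mJ => /andP[JE _] /eqP cJ.
by rewrite tmonE dhomogX; apply/eqP; rewrite -cJ; exact: mdeg_set_mnm.
Qed.

(** The chosen representatives and the forms [join_coef] are dual families, which gives linear
    independence. *)
Lemma join_coef_poly T U :
  join_coef (join_poly T) U = ((T == U) && (T \in join_sets G))%:R.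
Proof.
case: (boolP (T \in join_sets G)) => [/join_polyP[J mJ ->]|/join_poly_notin ->]; last first.
  by rewrite andbF join_coef0.
move: mJ; rewrite /min_join is_joinE => /andP[/andP[JE /eqP->] /eqP cJ].
rewrite tmonE join_coefX // /min_join is_joinE JE /= andbT eq_sym.
by case: (eqVneq _ U) => [<-|] //; rewrite cJ eqxx.
Qed.

Lemma join_coef_sum (I : Type) (r : seq I) (P : pred I) (F : I -> edge_ring K G) T :
  join_coef (\sum_(i <- r | P i) F i) T = \sum_(i <- r | P i) join_coef (F i) T.
Proof.
elim/big_rec2: _ => [|i x p _ <-]; first exact: join_coef0.
exact: join_coefD.
Qed.

Lemma eulerian_pi_sum (I : Type) (r : seq I) (P : pred I) (F : I -> edge_ring K G) :
  pi (\sum_(i <- r | P i) F i) = \sum_(i <- r | P i) pi (F i).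
Proof.
elim/big_rec2: _ => [|i x p _ <-]; first exact: eulerian_pi0.
exact: eulerian_piD.
Qed.

Lemma eulerian_pi_tmon_min T J : min_join G T J -> pi (t J) = join_class T.
Proof.
move=> mJ; have /andP[jJ /eqP cJ] := mJ.
have [|L /andP[jL /eqP cL] tL] := @join_polyP T; first by apply/join_setsP; exists J.
by rewrite /join_class tL; apply: eulerian_pi_tmon_join jJ jL _; rewrite cJ.
Qed.

Lemma eulerian_pi_tmon T J : is_join G T J ->
  pi (t J) = if #|J| == tau G T then join_class T else 0.
Proof.
move=> jJ; case: ifP => [cJ|/negbT cJ]; last exact: (eulerian_pi_tmon_nonmin K bipW jJ cJ).
by apply: eulerian_pi_tmon_min; rewrite /min_join jJ.
Qed.

(** Both sides are linear in p. On a monomial with a square both vanish, and on t_S the only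
    possible term is T = [boundary S], present exactly when S is minimal. *)
Lemma eulerian_pi_span p : pi p = \sum_T join_coef p T *: join_class T.
Proof.
elim/mpolyind: p => [|c m p _ _ IH].
  by rewrite eulerian_pi0 big1 // => T _; rewrite join_coef0 scale0r.
rewrite eulerian_piD IH eulerian_piZ.
under [RHS]eq_bigr do rewrite join_coefD join_coefZ scalerDl -scalerA.
rewrite big_split -scaler_sumr; congr (c *: _ + _).
have [[i lt]|[S SE ->]] := mnm_squarefree m.
  rewrite (eulerian_piX_nsq _ lt) big1 // => T _.
  by rewrite (join_coefX_nsq _ _ lt) scale0r.
have jS := is_join_boundary SE.
rewrite -tmonE (eulerian_pi_tmon jS).
rewrite (bigD1 (boundary S)) //= big1 ?addr0 => [|T neT]; rewrite tmonE join_coefX //.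
  by rewrite /min_join jS; case: (_ == _); rewrite ?scale1r ?scale0r.
by rewrite /min_join is_joinE (negPf neT) andbF scale0r.
Qed.

Lemma join_class_free (c : {set V} -> K) :
  \sum_T c T *: join_class T = 0 -> forall T, T \in join_sets G -> c T = 0.
Proof.
under eq_bigr do rewrite -eulerian_piZ.
rewrite -eulerian_pi_sum => /eulerian_pi_eq0 I0 T jT.
have := join_coef_ideal T I0; rewrite join_coef_sum (bigD1 T) //= big1 => [|U neU].
  by rewrite join_coefZ join_coef_poly eqxx jT mulr1 addr0.
by rewrite join_coefZ join_coef_poly (negPf neU) mulr0.
Qed.

Lemma join_sets_symdiff T e : e \in edges G ->
  (symdiff T e \in join_sets G) = (T \in join_sets G).
Proof.
move=> /is_join_edge je.
apply/join_setsP/join_setsP => -[J jJ]; exists (symdiff J [set e]).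
  by rewrite -[T](symdiffK _ e); apply: is_join_symdiff.
exact: is_join_symdiff.
Qed.

Lemma mul_edge_join_class e T : e \in edges G ->
  pi (t [set e]) * join_class T =
    if tau G (symdiff T e) == (tau G T).+1 then join_class (symdiff T e) else 0.
Proof.
move=> eE; case: (boolP (T \in join_sets G)) => [jT|nT]; last first.
  rewrite /join_class !join_poly_notin ?join_sets_symdiff //.
  by rewrite eulerian_pi0 mulr0 if_same.
have [J /andP[jJ /eqP cJ] tJ] := join_polyP jT.
rewrite {1}/join_class tJ; have jTe := is_join_symdiff jJ (is_join_edge eE).
(* If e lies in J, the product contains t_e^2, and J without e shows that tau drops. Otherwise J
   with e added is a join of size tau T + 1, whose class is nonzero only if it is minimal. *)
case: (boolP (e \in J)) => eJ.
  rewrite (eulerian_pi_tmonM_eq0 K eE (set11 e) eJ); case: eqP => // teq.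
  have := tau_le jTe; have := card_symdiff J [set e].
  by rewrite (setIidPr _) ?sub1set // cards1; lia.
have dJe : [disjoint J & [set e]] by rewrite disjoint_sym disjoints1.
rewrite -eulerian_piM mulrC -tmonU // -symdiff_disjoint // (eulerian_pi_tmon jTe).
by rewrite symdiff_disjoint // setUC cardsU1 eJ cJ eq_sym.
Qed.

(** Toggling e in a minimal join changes its size by one, so tau changes by at most one in either
    direction; parity rules out equality. *)
Lemma tau_symdiff_edge T e : T \in join_sets G -> e \in edges G ->
  tau G (symdiff T e) = (tau G T).+1 \/ (tau G (symdiff T e)).+1 = tau G T.
Proof.
move=> /join_sets_min[J /andP[jJ /eqP cJ]] eE; have je := is_join_edge eE.
have jTe := is_join_symdiff jJ je; have [L jL cL] := tau_attained jTe.
have jT : is_join G T (symdiff L [set e]).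
  by rewrite -[T](symdiffK _ e); apply: is_join_symdiff.
have := tau_le jTe; have := tau_le jT.
have := card_symdiff J [set e]; have := card_symdiff L [set e]; rewrite cards1.
have := odd_card_join bipW jT; rewrite -(odd_card_join bipW jJ).
by rewrite cL cJ; lia.
Qed.

Lemma eulerian_span_join (u : A) : exists2 c : {set V} -> K,
  (forall T, c T != 0 -> T \in join_sets G) & u = \sum_T c T *: join_class T.
Proof.
have [p ->] := eulerian_pi_surj u; exists (join_coef p); last exact: eulerian_pi_span.
move=> T; apply: contraNT => nT; rewrite /join_coef big1 // => J /andP[jJ _].
by case/join_setsP: nT; exists J.
Qed.

(** Every monomial read by [join_coef p T] has degree tau T, so for p homogeneous of degree d this
    coefficient vanishes unless tau T = d. *)
Lemma homog_partP d (u : A) : homog_part d u <->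
  exists2 c : {set V} -> K, (forall T, c T != 0 -> T \in join_sets G /\ tau G T = d) &
    u = \sum_T c T *: join_class T.
Proof.
split=> [[p [hp ->]]|[c hc ->]]; last first.
  exists (\sum_T c T *: join_poly T); split.
    rewrite rpred_sum // => T _; case: (eqVneq (c T) 0) => [->|/hc[_ <-]].
      by rewrite scale0r rpred0.
    by rewrite rpredZ // join_poly_homog.
  by rewrite eulerian_pi_sum; apply: eq_bigr => T _; rewrite eulerian_piZ.
exists (join_coef p) => [T|]; last exact: eulerian_pi_span.
rewrite /join_coef => nz.
have [J mJ cJ] : exists2 J, min_join G T J & p@_(set_mnm G J) != 0.
  apply/exists_inP; apply: contraNT nz => /exists_inPn z; apply/eqP/big1=> J mJ.
  by apply/eqP; have := z J mJ; rewrite negbK.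
have /andP[jJ /eqP cardJ] := mJ; split; first by apply/join_setsP; exists J.
have JE : J \subset edges G by case/andP: jJ.
rewrite -cardJ -(mdeg_set_mnm JE).
by apply/eqP; apply: contraNT cJ => /(dhomog_nemf_coeff hp) ->.
Qed.

Lemma eulerian_scaleAr c (u v : A) : u * (c *: v) = c *: (u * v).
Proof. exact: mulrCA. Qed.

Lemma socle_edges (u : A) :
  socle u <-> forall e, e \in edges G -> pi (t [set e]) * u = 0.
Proof.
split=> [su e eE|su p [s [Xs ->]]].
  apply: su; rewrite (tmon_set1 _ eE); exists [:: (1, 'X_(enum_rank_in eE e))].
  by rewrite big_seq1 mul1r; split=> // q; rewrite inE => /eqP->; eexists.
rewrite eulerian_pi_sum mulr_suml big1_seq // => q /andP[_ /Xs[i qi]].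
rewrite eulerian_piM -mulrA qi -[i](enum_valK_in (enum_valP i)).
by rewrite -tmon_set1 ?enum_valP // su ?mulr0 ?enum_valP.
Qed.

(** Multiplication by t_e sends the classes of distinct T to classes of distinct sets or to 0,
    without cancellation. Hence t_e u = 0 kills the coefficient of each T for which tau increases
    along e. *)
Lemma socleP (u : A) : socle u <->
  exists2 c : {set V} -> K, (forall T, c T != 0 -> socle_set G T) &
    u = \sum_T c T *: join_class T.
Proof.
rewrite socle_edges; split=> [su|[c cs ->] e eE]; last first.
  rewrite mulr_sumr big1 // => T _; rewrite eulerian_scaleAr mul_edge_join_class //.
  case: (eqVneq (c T) 0) => [->|/cs[_ /(_ e eE)]]; first by rewrite scale0r.
  by case: eqP => [|_ _]; [lia | rewrite scaler0].
have [c cJ uE] := eulerian_span_join u; exists c => // T cT.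
have jT := cJ T cT; split=> // e eE.
case: (tau_symdiff_edge jT eE) => // up; case/eqP: cT.
(* [d U] is the coefficient of U in t_e u, obtained by reindexing along the involution U -> U
   \triangle e. *)
pose d U := if tau G U == (tau G (symdiff U e)).+1 then c (symdiff U e) else 0.
have inv : involutive (fun U : {set V} => symdiff U e) by move=> U; apply: symdiffK.
have d0 : \sum_U d U *: join_class U = 0.
  rewrite -[RHS](su e eE) uE mulr_sumr [RHS](reindex_inj (inv_inj inv)).
  apply: eq_bigr => U _; rewrite eulerian_scaleAr mul_edge_join_class // /d symdiffK.
  by case: eqP => _; rewrite ?scaler0 ?scale0r.
have := join_class_free d0 (_ : symdiff T e \in join_sets G).
by rewrite join_sets_symdiff // /d symdiffK up eqxx; apply.
Qed.

(** Serves both the graded pieces and the socle, each being spanned by the classes of a known list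
    of sets. *)
Lemma join_class_basis (X : A -> Prop) (s : seq {set V}) d :
    size s = d -> uniq s -> {subset s <= join_sets G} ->
    (forall u, X u <-> exists2 c : {set V} -> K,
        (forall T, c T != 0 -> T \in s) & u = \sum_T c T *: join_class T) ->
  is_basis X (fun i : 'I_d => join_class (nth set0 s i)).
Proof.
move=> <- us sJ XP.
(* Turns a combination indexed by positions in s into one indexed by all subsets of V. *)
have nthK (c : 'I_(size s) -> K) (F : {set V} -> A) :
    \sum_T (\sum_(i < size s) (if nth set0 s i == T then c i else 0)) *: F T
    = \sum_(i < size s) c i *: F (nth set0 s i).
  under eq_bigr do rewrite scaler_suml; rewrite exchange_big; apply: eq_bigr => i _.
  rewrite (bigD1 (nth set0 s i)) //= eqxx big1 ?addr0 // => T neT.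
  by rewrite eq_sym (negPf neT) scale0r.
split=> [u|c].
  rewrite XP; split=> [[c cs ->]|[c ->]].
    exists (fun i => c (nth set0 s i)).
    rewrite (bigID (mem s)) /= [X in _ + X]big1 => [|T]; last first.
      by move=> Ts; case: (eqVneq (c T) 0) Ts => [->|/cs->//]; rewrite scale0r.
    by rewrite addr0 -big_uniq // (big_nth set0) big_mkord.
  eexists; last by rewrite -nthK; reflexivity.
  move=> T; apply: contraNT => Ts; rewrite big1 // => i _.
  by case: eqP Ts => // <-; rewrite mem_nth.
rewrite -nthK => /join_class_free c0 i.
have := c0 (nth set0 s i) (sJ _ (mem_nth set0 (ltn_ord i))).
rewrite (bigD1 i) //= eqxx big1 ?addr0 // => j neji.
by rewrite nth_uniq // (inj_eq val_inj) (negPf neji).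
Qed.

Lemma homog_part_join_class T : homog_part (tau G T) (join_class T).
Proof. by exists (join_poly T); split; first exact: join_poly_homog. Qed.

Lemma has_dim_homog_part d :
  has_dim (@homog_part K V G d) #|[set T in join_sets G | tau G T == d]|.
Proof.
set D := [set T in _ | _]; eexists; apply: (@join_class_basis _ (enum D)).
- by rewrite -cardE.
- exact: enum_uniq.
- by move=> T; rewrite mem_enum inE => /andP[].
move=> u; rewrite homog_partP; split=> -[c cD ->]; exists c => // T /cD.
  by case=> jT tT; rewrite mem_enum inE jT tT eqxx.
by rewrite mem_enum inE => /andP[? /eqP].
Qed.

Lemma socle_degrees_tau (s : seq {set V}) : uniq s ->
  (forall T, socle_set G T <-> T \in s) -> socle_degrees K G (map (tau G) s).
Proof.
move=> us sP; exists (fun i => join_class (nth set0 s i)); split=> [|i].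
  apply: join_class_basis => //; first by rewrite size_map.
    by move=> T /sP[].
  by move=> u; rewrite socleP; split=> -[c cs ->]; exists c => // T /cs /sP.
rewrite (nth_map set0); first exact: homog_part_join_class.
by rewrite -(size_map (tau G)).
Qed.

Lemma level_tau d : (forall T, socle_set G T -> tau G T = d) -> level K G.
Proof.
move=> sd; exists d => u /socleP[c cs ->].
elim: (index_enum _) => [|T s IH]; first by rewrite big_nil; apply: ideal_span0.
rewrite big_cons; case: (eqVneq (c T) 0) => [->|cT]; first by rewrite scale0r add0r.
apply: ideal_spanMD IH; exists [:: (1, join_class T)].
rewrite big_seq1 mul1r; split=> // v; rewrite inE => /eqP-> /=.
rewrite -(sd T (cs T cT)); split; last exact: homog_part_join_class.
apply/socleP; exists (fun U => (U == T)%:R) => [U|].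
  by case: (eqVneq U T) => [-> _|]; [apply: cs | rewrite eqxx].
rewrite (bigD1 T) //= eqxx scale1r big1 ?addr0 // => U /negPf->.
by rewrite scale0r.
Qed.

End JoinClasses.

(** * Complete bipartite graphs *)

Section CompleteBipartite.

Variables (V : finType) (G : sgraph V).
Implicit Types (W T : {set V}).

Lemma complete_bipartite_sym (V1 V2 : {set V}) :
  complete_bipartite G V1 V2 -> complete_bipartite G V2 V1.
Proof.
case=> cov dis eG; split; rewrite 1?setUC 1?disjoint_sym // eG.
by apply/setP=> e; apply/imset2P/imset2P => -[x y xV yV ->]; exists y x; rewrite // setUC.
Qed.

Lemma edge_cap (V1 V2 : {set V}) x y : complete_bipartite G V1 V2 -> x \in V1 -> y \in V2 ->
  [set x; y] :&: V1 = [set x].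
Proof.
case=> cov dis eG xV yV; apply/setP=> z; rewrite !inE.
case: (eqVneq z x) => [->|] //=; case: (eqVneq z y) => [->|] //=.
by rewrite (disjointFl dis yV).
Qed.

Lemma complete_bipartiteP (V1 V2 : {set V}) e : complete_bipartite G V1 V2 ->
  reflect (exists x y, [/\ x \in V1, y \in V2 & e = [set x; y]]) (e \in edges G).
Proof.
case=> _ _ ->; apply: (iffP imset2P) => [[x y xV yV ->]|[x [y [xV yV ->]]]].
  by exists x, y.
by exists x y.
Qed.

Lemma bipartition_complete (V1 V2 : {set V}) : complete_bipartite G V1 V2 -> bipartition G V1.
Proof.
move=> cG e /(complete_bipartiteP _ cG)[x [y [xV yV ->]]].
by rewrite (edge_cap cG) ?cards1.
Qed.

Lemma card_symdiff_edge (V1 V2 : {set V}) T x y : complete_bipartite G V1 V2 ->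
    x \in V1 -> y \in V2 ->
  #|symdiff T [set x; y] :&: V1|
    = if x \in T then #|T :&: V1|.-1 else #|T :&: V1|.+1.
Proof.
move=> cG xV yV.
have -> : symdiff T [set x; y] :&: V1 = symdiff (T :&: V1) [set x].
  rewrite -[X in _ = symdiff _ X](edge_cap cG xV yV).
  by apply/setP=> z; rewrite !(in_symdiff, inE) andb_addl.
have := card_symdiff (T :&: V1) [set x]; rewrite cards1.
case: ifP => xT.
  by rewrite (_ : _ :&: [set x] = [set x]) ?cards1; [lia|];
    apply/setIidPr; rewrite sub1set inE xT.
rewrite (_ : _ :&: [set x] = set0) ?cards0; first lia.
by apply/setP=> z; rewrite !inE; case: eqP => [->|]; rewrite ?xT ?andbF.
Qed.

Lemma card_bipartition (V1 V2 : {set V}) T : complete_bipartite G V1 V2 ->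
  #|T :&: V1| + #|T :&: V2| = #|T|.
Proof.
case=> cov dis _; rewrite -(cardsID V1 T); congr (_ + #|pred_of_set _|).
apply/setP=> z; rewrite !inE.
have : z \in V1 :|: V2 by rewrite cov inE.
rewrite inE andbC; case: (boolP (z \in V1)) => //= [/(disjointFr dis) ->|_ ->] //.
Qed.

(** A vertex of T has odd degree in J, hence lies on an edge of J, and an edge has only one endpoint
    in W. *)
Lemma join_ge_bipartition W T J : bipartition G W -> is_join G T J ->
  #|T :&: W| <= #|J|.
Proof.
move=> bW; rewrite is_joinE => /andP[JE /eqP->].
have [->|[v0 _]] := set_0Vmem (boundary J :&: W); first by rewrite cards0.
(* [f] sends an edge to its endpoint in W; [v0] only makes it total. *)
pose f (e : {set V}) := odflt v0 [pick v in e :&: W].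
apply: leq_trans (leq_imset_card f J); apply/subset_leq_card/subsetP => v.
rewrite !inE => /andP[od vW].
have /card_gt0P[e] : 0 < #|[set e in J | v \in e]| by move: od; rewrite /edeg; case: #|_|.
rewrite inE => /andP[eJ ve]; apply/imsetP; exists e => //.
have /cards1P[w eW] : #|e :&: W| == 1 by rewrite (bW e) ?(subsetP JE).
have : v \in e :&: W by rewrite inE ve.
rewrite /f eW inE => /eqP->; case: pickP => [u|/(_ w)]; rewrite inE ?eqxx //.
by move/eqP.
Qed.

Definition max_side (V1 V2 : {set V}) T := maxn #|T :&: V1| #|T :&: V2|.

Lemma max_sideC (V1 V2 : {set V}) T : max_side V1 V2 T = max_side V2 V1 T.
Proof. exact: maxnC. Qed.

(** Remove a vertex x from the larger trace of T. If the traces are equal, y must be removed from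
    the other; if not, evenness makes them differ by at least two, so even adding y to the smaller
    one is harmless. *)
Lemma max_side_descent (V1 V2 : {set V}) T : complete_bipartite G V1 V2 ->
    0 < #|V1| -> 0 < #|V2| -> ~~ odd #|T| -> T != set0 ->
  exists2 e, e \in edges G & (max_side V1 V2 (symdiff T e)).+1 = max_side V1 V2 T.
Proof.
wlog le : V1 V2 / #|T :&: V2| <= #|T :&: V1| => [wl cG c1 c2 ev T0|cG c1 c2 ev T0].
  case: (leqP #|T :&: V2| #|T :&: V1|) => [le|/ltnW le]; first exact: wl.
  have [e eE me] := wl V2 V1 le (complete_bipartite_sym cG) c2 c1 ev T0.
  by exists e; rewrite // !(max_sideC V1).
have cT := card_bipartition T cG.
have T1 : 0 < #|T :&: V1| by move: T0; rewrite -card_gt0; lia.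
have /card_gt0P[x] := T1; rewrite inE => /andP[xT xV].
have [y yV yT] : exists2 y, y \in V2 & #|T :&: V2| = #|T :&: V1| -> y \in T.
  case: (posnP #|T :&: V2|) => [z|/card_gt0P[y]].
    by case/card_gt0P: c2 => y yV; exists y => //; lia.
  by rewrite inE => /andP[yT yV]; exists y.
exists [set x; y]; first by apply/(complete_bipartiteP _ cG); exists x, y.
have := card_symdiff_edge T (complete_bipartite_sym cG) yV xV.
rewrite /max_side setUC (card_symdiff_edge T cG xV yV) xT => ->.
by case: ifP yT => yT; lia.
Qed.

(** Greedy construction: each descent step costs one edge and lowers [max_side] by one, until T is
    empty. *)
Lemma exists_join_max_side (V1 V2 : {set V}) T : complete_bipartite G V1 V2 ->
    0 < #|V1| -> 0 < #|V2| -> ~~ odd #|T| ->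
  exists2 J, is_join G T J & #|J| <= max_side V1 V2 T.
Proof.
move=> cG c1 c2; elim: {T}_.+1 {-2}T (ltnSn (max_side V1 V2 T)) => // k IH T lt ev.
case: (eqVneq T set0) => [->|T0].
  by exists set0; rewrite ?is_joinE ?sub0set ?boundary0 ?eqxx ?cards0.
have [e eE me] := max_side_descent cG c1 c2 ev T0.
have [J jJ cJ] := IH (symdiff T e) ltac:(lia) ltac:(by
  have := card_symdiff T e; rewrite (edges_card2 eE); lia).
exists (symdiff J [set e]).
  by rewrite -[T](symdiffK _ e); apply: is_join_symdiff => //; apply: is_join_edge.
by have := card_symdiff J [set e]; rewrite cards1; lia.
Qed.

Lemma tau_complete_bipartite (V1 V2 : {set V}) T : complete_bipartite G V1 V2 ->
    0 < #|V1| -> 0 < #|V2| -> ~~ odd #|T| -> tau G T = max_side V1 V2 T.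
Proof.
move=> cG c1 c2 ev; have [J jJ cJ] := exists_join_max_side cG c1 c2 ev.
have [L jL cL] := tau_attained jJ; apply/eqP.
rewrite eqn_leq (leq_trans (tau_le jJ) cJ) -cL geq_max.
have bip := bipartition_complete cG.
have bip' := bipartition_complete (complete_bipartite_sym cG).
by rewrite !join_ge_bipartition.
Qed.

Lemma join_sets_complete_bipartite (V1 V2 : {set V}) T : complete_bipartite G V1 V2 ->
  0 < #|V1| -> 0 < #|V2| -> (T \in join_sets G) = ~~ odd #|T|.
Proof.
move=> cG c1 c2; apply/idP/idP => [|ev]; rewrite inE; last first.
  by have [J jJ _] := exists_join_max_side cG c1 c2 ev; apply/existsP; exists J.
case/existsP=> J jJ; rewrite -(card_bipartition T cG) oddD.
rewrite -(odd_card_join (bipartition_complete cG) jJ).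
by rewrite -(odd_card_join (bipartition_complete (complete_bipartite_sym cG)) jJ) addbb.
Qed.

(** If the trace on V1 is a largest one and misses x, toggling an edge at x enlarges it, so the
    maximum cannot drop. *)
Lemma side_full (V1 V2 : {set V}) T : complete_bipartite G V1 V2 -> 0 < #|V2| ->
    (forall e, e \in edges G -> max_side V1 V2 (symdiff T e) < max_side V1 V2 T) ->
  #|T :&: V1| = max_side V1 V2 T -> T :&: V1 = V1.
Proof.
move=> cG /card_gt0P[y yV] dec mx; apply/setIidPr/subsetP => x xV.
have := dec [set x; y]; rewrite -mx /max_side (card_symdiff_edge T cG xV yV).
case: ifP => // xT; case/implyP; rewrite implybE.
by rewrite (_ : _ \in edges G); [lia | apply/(complete_bipartiteP _ cG); exists x, y].
Qed.

Lemma socle_set_complete_bipartite (V1 V2 : {set V}) T : complete_bipartite G V1 V2 ->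
    0 < #|V1| -> 0 < #|V2| -> ~~ odd #|T| ->
  socle_set G T <->
    (#|T :&: V1| = max_side V1 V2 T -> T :&: V1 = V1) /\
    (#|T :&: V2| = max_side V1 V2 T -> T :&: V2 = V2).
Proof.
move=> cG c1 c2 ev; have cG' := complete_bipartite_sym cG.
have cT := card_bipartition T cG.
have evS e : e \in edges G -> ~~ odd #|symdiff T e|.
  by move=> eE; have := card_symdiff T e; rewrite (edges_card2 eE); lia.
have tauE e : e \in edges G -> tau G (symdiff T e) = max_side V1 V2 (symdiff T e).
  by move=> eE; apply: tau_complete_bipartite; rewrite ?evS.
rewrite /socle_set (join_sets_complete_bipartite T cG c1 c2) ev.
rewrite (tau_complete_bipartite cG c1 c2 ev).
split=> [[_ ss]|[s1 s2]].
  have dec e : e \in edges G -> max_side V1 V2 (symdiff T e) < max_side V1 V2 T.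
    by move=> eE; rewrite -tauE // ss.
  split; first exact: side_full dec.
  by rewrite max_sideC; apply: side_full => // e /dec; rewrite !(max_sideC V1).
split=> // e eE; rewrite tauE //.
have /(complete_bipartiteP _ cG)[x [y [xV yV eE']]] := eE; subst e.
have := card_symdiff_edge T cG' yV xV; rewrite /max_side setUC.
rewrite (card_symdiff_edge T cG xV yV) => ->.
(* On each side the endpoint of e is removed from T, unless that trace is strictly smaller; evenness
   then makes the gap at least two, enough to absorb an added vertex. *)
have V1T : #|T :&: V1| < max_side V1 V2 T \/ x \in T.
  case: (eqVneq #|T :&: V1| (max_side V1 V2 T)) => [/s1 h|ne].
    by right; move: xV; rewrite -h inE => /andP[].
  by left; rewrite ltn_neqAle ne leq_maxl.
have V2T : #|T :&: V2| < max_side V1 V2 T \/ y \in T.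
  case: (eqVneq #|T :&: V2| (max_side V1 V2 T)) => [/s2 h|ne].
    by right; move: yV; rewrite -h inE => /andP[].
  by left; rewrite ltn_neqAle ne leq_maxr.
(* If the maximum were 0, the trace on V1 would be maximal, hence all of the non-empty set V1. *)
have T0 : 0 < max_side V1 V2 T.
  rewrite lt0n; apply/eqP => m0; move: s1; rewrite m0 =>
    /(_ ltac:(rewrite /max_side in m0; lia)).
  by move=> TV; rewrite -TV in c1; rewrite /max_side in m0; lia.
move: V1T V2T T0; rewrite /max_side.
by case: (x \in T); case: (y \in T) => -[] V1T [] V2T; lia.
Qed.

End CompleteBipartite.

(** * Counting *)

Section Counting.

Variables (V : finType).
Implicit Types (S T W : {set V}).

(** The index k corresponds to |S| = i - 2k, so the lower limit k >= m reads |S| + 2m <= i. *)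
Lemma card_subsets_parity (W : {set V}) i m :
  #|[set S : {set V} | (S \subset W) && ((#|S| + 2 * m <= i) && (odd #|S| == odd i))]|
    = \sum_(m <= k < i.+1 | 2 * k <= i) 'C(#|W|, i - 2 * k).
Proof.
case: (leqP m i.+1) => [mi|im]; last first.
  rewrite big_geq; last exact: ltnW.
  by apply/eqP; rewrite cards_eq0; apply/eqP/setP=> S; rewrite !inE; lia.
rewrite -sum1_card (eq_bigl _ _ (in_set _)).
rewrite (partition_big (fun S : {set V} => inord (i - #|S|)./2 : 'I_i.+1)
  (fun k : 'I_i.+1 => (m <= k) && (2 * k <= i))) /=; last first.
  by move=> S /andP[_ /andP[le od]]; rewrite inordK; lia.
rewrite (big_nat_widenl _ 0) // big_mkord.
apply: eq_big => [k|k /andP[le1 le2]]; first by rewrite andbC.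
rewrite -cards_draws -sum1_card; apply: eq_bigl => S; rewrite inE.
case: (S \subset W) => //=; have ltk := ltn_ord k.
apply/andP/eqP => [[/andP[le od] /eqP/(congr1 val)]|cS].
  by rewrite /= inordK; lia.
split; first lia.
by apply/eqP/val_inj; rewrite /= inordK; lia.
Qed.

(** The traces on the two sides determine T and can be prescribed independently. *)
Lemma card_product_bipartition (V1 V2 : {set V}) (P1 P2 : pred {set V}) :
    V1 :|: V2 = [set: V] -> [disjoint V1 & V2] ->
  #|[set T : {set V} | P1 (T :&: V1) && P2 (T :&: V2)]|
    = #|[set S : {set V} | (S \subset V1) && P1 S]| *
      #|[set S : {set V} | (S \subset V2) && P2 S]|.
Proof.
move=> cov dis; set D := [set T : {set V} | _]; rewrite -cardsX.
have inj : injective (fun T : {set V} => (T :&: V1, T :&: V2)).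
  move=> T U [e1 e2].
  by rewrite -[T]setIT -[U]setIT -cov !setIUr e1 e2.
rewrite -(card_imset _ inj); apply: eq_card => -[S1 S2].
apply/imsetP/setXP => [[T TD [-> ->]]|[]].
  by move: TD; rewrite !inE !subsetIr /= => /andP[].
rewrite !inE => /andP[S1V p1] /andP[S2V p2].
have capU (A B U W : {set V}) :
    [disjoint U & W] -> A \subset U -> B \subset W -> (A :|: B) :&: U = A.
  move=> dUW AU BW; rewrite setIUl (setIidPl AU) (_ : B :&: U = set0) ?setU0 //.
  by apply/disjoint_setI0; apply: disjointWl BW _; rewrite disjoint_sym.
have e1 : (S1 :|: S2) :&: V1 = S1 by apply: capU dis S1V S2V.
have e2 : (S1 :|: S2) :&: V2 = S2.
  by rewrite setUC; apply: capU S2V S1V; rewrite disjoint_sym.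
by exists (S1 :|: S2); rewrite ?inE e1 e2 // p1.
Qed.

Lemma card_odd_subsets (W : {set V}) b : 0 < #|W| ->
  #|[set S : {set V} | (S \subset W) && (odd #|S| == b)]| = 2 ^ #|W|.-1.
Proof.
move=> W0; have /card_gt0P[w wW] := W0.
pose half c := [set S : {set V} | (S \subset W) && (odd #|S| == c)].
(* Toggling the fixed vertex w reverses the parity injectively; used for both values of c, this
   gives equality. *)
have swap c : #|half c| <= #|half (~~ c)|.
  have inj : injective (fun S : {set V} => symdiff S [set w]).
    by move=> S T e; rewrite -[S](symdiffK _ [set w]) e symdiffK.
  rewrite -(card_imset _ inj); apply/subset_leq_card/subsetP => _ /imsetP[S + ->].
  rewrite !inE => /andP[SW /eqP <-]; rewrite symdiff_sub ?sub1set //=.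
  by have := card_symdiff S [set w]; rewrite cards1; lia.
have := card_powerset W; rewrite -(cardsID (half b)).
have -> : powerset W :&: half b = half b.
  by apply/setP=> S; rewrite !inE; case: (S \subset W).
have -> : powerset W :\: half b = half (~~ b).
  by apply/setP=> S; rewrite !inE; case: (S \subset W); case: (odd _); case: b.
have := swap (~~ b); have := swap b; rewrite negbK -[in 2 ^ #|W|](prednK W0) expnS.
by rewrite -/(half b); lia.
Qed.

End Counting.

(** Numbers of equal parity have maximum i exactly when both are at most i with the parity of i, but
    not both at most i - 2. This is where the difference of products in the h-vector comes from; the
    factors 2 * 1 and 2 * 0 match [card_subsets_parity]. *)
Lemma max_eq_parity n1 n2 i :
  ~~ odd (n1 + n2) && (maxn n1 n2 == i) =
    ~~ (((n1 + 2 * 1 <= i) && (odd n1 == odd i)) &&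
        ((n2 + 2 * 1 <= i) && (odd n2 == odd i))) &&
    (((n1 + 2 * 0 <= i) && (odd n1 == odd i)) &&
     ((n2 + 2 * 0 <= i) && (odd n2 == odd i))).
Proof.
have step n : odd n = odd i -> (n + 2 * 1 <= i) = (n < i) by move=> e; lia.
rewrite oddD !muln0 !addn0.
case: (eqVneq (odd n1) (odd i)) => [e1|ne1]; last first.
  rewrite !(andbF, andFb); apply/negbTE; apply: contra ne1 => /andP[ev /eqP <-].
  by case: (leqP n1 n2) ev => _; case: (odd n1); case: (odd n2).
case: (eqVneq (odd n2) (odd i)) => [e2|ne2]; last first.
  rewrite !(andbF, andFb); apply/negbTE; apply: contra ne2 => /andP[ev /eqP <-].
  by case: (leqP n1 n2) ev => _; case: (odd n1); case: (odd n2).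
rewrite !step // e1 e2 addbb !andbT /= eqn_leq geq_max leq_max !ltnNge.
by case: (i <= n1); case: (i <= n2); rewrite ?andbT ?andbF.
Qed.

(** * Graded dimensions and socle degrees of the complete bipartite graph *)

Section SocleSets.

Variables (V : finType) (G : sgraph V) (V1 V2 : {set V}).
Hypothesis cG : complete_bipartite G V1 V2.
Hypotheses (V1_gt0 : 0 < #|V1|) (V2_gt0 : 0 < #|V2|).
Implicit Types (S T : {set V}).

Lemma card_tau_eq i :
  #|[set T in join_sets G | tau G T == i]| =
    (\sum_(0 <= k < i.+1 | 2 * k <= i) 'C(#|V1|, i - 2 * k)) *
    (\sum_(0 <= k < i.+1 | 2 * k <= i) 'C(#|V2|, i - 2 * k)) -
    (\sum_(1 <= k < i.+1 | 2 * k <= i) 'C(#|V1|, i - 2 * k)) *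
    (\sum_(1 <= k < i.+1 | 2 * k <= i) 'C(#|V2|, i - 2 * k)).
Proof.
have [cov dis _] := cG; rewrite -!card_subsets_parity.
rewrite -!(card_product_bipartition _ _ cov dis).
set P := [set T : {set V} | _]; set Q := [set T : {set V} | _].
(* The inclusion makes the truncated subtraction exact. *)
have QP : Q \subset P.
  apply/subsetP=> T; rewrite !inE => /andP[/andP[le1 ->] /andP[le2 ->]].
  by rewrite !andbT muln0 !addn0 (leq_trans (leq_addr _ _) le1) (leq_trans (leq_addr _ _) le2).
rewrite -(cardsDS QP); apply: eq_card => T.
rewrite [LHS]inE (join_sets_complete_bipartite T cG V1_gt0 V2_gt0) !inE.
rewrite -max_eq_parity (card_bipartition T cG); case: (boolP (odd #|T|)) => //= ev.
by rewrite (tau_complete_bipartite cG).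
Qed.

Lemma cap_full (W : {set V}) T : (T :&: W == W) = (#|W| <= #|T :&: W|).
Proof. by rewrite eqEcard subsetIr. Qed.

Lemma cap_leq (W : {set V}) T : #|T :&: W| <= #|W|.
Proof. exact: subset_leq_card (subsetIr _ _). Qed.

(** The even sets that contain V1 and have a strictly smaller trace on V2, written with + 2 and a
    parity test to fit [card_subsets_parity]. *)
Definition socle1 := [set T : {set V} |
  (T :&: V1 == V1) &&
    ((#|T :&: V2| + 2 * 1 <= #|V1|) && (odd #|T :&: V2| == odd #|V1|))].

Definition socle2 := [set T : {set V} |
  ((#|T :&: V1| + 2 * 1 <= #|V2|) && (odd #|T :&: V1| == odd #|V2|)) &&
    (T :&: V2 == V2)].

Lemma card_full (W : {set V}) : #|[set S : {set V} | (S \subset W) && (S == W)]| = 1.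
Proof.
rewrite (_ : [set _ | _] = [set W]) ?cards1 //; apply/setP=> S; rewrite !inE.
by case: eqP => [->|_]; rewrite ?subxx ?andbF.
Qed.

Lemma card_socle1 :
  #|socle1| = \sum_(1 <= k < #|V1|.+1 | 2 * k <= #|V1|) 'C(#|V2|, #|V1| - 2 * k).
Proof.
have [cov dis _] := cG.
rewrite [LHS](card_product_bipartition (fun S => S == V1)
  (fun S => (#|S| + 2 * 1 <= #|V1|) && (odd #|S| == odd #|V1|)) cov dis).
by rewrite card_full mul1n card_subsets_parity.
Qed.

Lemma card_socle2 :
  #|socle2| = \sum_(1 <= k < #|V2|.+1 | 2 * k <= #|V2|) 'C(#|V1|, #|V2| - 2 * k).
Proof.
have [cov dis _] := cG.
rewrite [LHS](card_product_bipartition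
  (fun S => (#|S| + 2 * 1 <= #|V2|) && (odd #|S| == odd #|V2|)) (fun S => S == V2)
  cov dis).
by rewrite card_full muln1 card_subsets_parity.
Qed.

(** A form in cardinalities only, which leaves the classification of socle sets to linear
    arithmetic. *)
Lemma socle_setE T : socle_set G T <->
  ~~ odd #|T| /\
  (((#|V1| <= #|T :&: V1|) || (#|T :&: V1| < #|T :&: V2|)) &&
   ((#|V2| <= #|T :&: V2|) || (#|T :&: V2| < #|T :&: V1|))).
Proof.
have full W : T :&: W = W <-> #|W| <= #|T :&: W|.
  by rewrite -cap_full; split=> /eqP.
split=> [ss|[ev st]]; last first.
  apply/(socle_set_complete_bipartite cG) => //; rewrite /max_side.
  by split=> mx; apply/full; lia.
have ev : ~~ odd #|T|.
  by case: ss; rewrite (join_sets_complete_bipartite T cG).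
split=> //; move: ss; rewrite (socle_set_complete_bipartite cG) // /max_side.
rewrite !full => -[s1 s2]; apply/andP; split.
  by case: ltnP => [|le]; rewrite ?orbT // orbF; apply: s1; lia.
by case: ltnP => [|le]; rewrite ?orbT // orbF; apply: s2; lia.
Qed.

(** Equal traces would both be full, contrary to |V1| < |V2|. So exactly one trace is larger, it is
    full, and its size is the socle degree: [socle1] and [socle2] are the two cases. *)
Lemma socle_degrees_lt (K : fieldType) : #|V1| < #|V2| ->
  socle_degrees K G
    (nseq (\sum_(1 <= i < #|V1|.+1 | 2 * i <= #|V1|) 'C(#|V2|, #|V1| - 2 * i)) #|V1| ++
     nseq (\sum_(1 <= i < #|V2|.+1 | 2 * i <= #|V2|) 'C(#|V1|, #|V2| - 2 * i)) #|V2|).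
Proof.
move=> lt12; rewrite -card_socle1 -card_socle2.
have tau1 T : T \in socle1 -> tau G T = #|V1|.
  rewrite inE cap_full => h; have cT := card_bipartition T cG; have le := cap_leq V1 T.
  by rewrite (tau_complete_bipartite cG) // /max_side; lia.
have tau2 T : T \in socle2 -> tau G T = #|V2|.
  rewrite inE cap_full => h; have cT := card_bipartition T cG; have le := cap_leq V2 T.
  by rewrite (tau_complete_bipartite cG) // /max_side; lia.
have mapE (D : {set {set V}}) d : (forall T, T \in D -> tau G T = d) ->
    map (tau G) (enum D) = nseq #|D| d.
  move=> tD; rewrite cardE -(size_map (tau G)); apply/all_pred1P/allP => _ /mapP[T + ->].
  by rewrite mem_enum => /tD ->; apply/eqP.
rewrite -(mapE _ _ tau1) -(mapE _ _ tau2) -map_cat.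
apply: (socle_degrees_tau K (bipartition_complete cG)).
  rewrite cat_uniq !enum_uniq andbT /=; apply/hasPn => T.
  rewrite !mem_enum => /tau2 t2; apply/negP => /tau1; lia.
move=> T; rewrite mem_cat !mem_enum socle_setE !inE !cap_full.
have cT := card_bipartition T cG; have le1 := cap_leq V1 T; have le2 := cap_leq V2 T.
by split=> [[ev st]|st]; lia.
Qed.

(** * Sides of equal size *)

Section Balanced.

Hypothesis eq12 : #|V1| = #|V2|.

Definition balanced_socle := [set T : {set V} | ~~ odd #|T| &
  (T :&: V1 == V1) || (T :&: V2 == V2)].

(** With equal sides a full trace is a largest one, and if the other trace is as large, it is full
    too. *)
Lemma balanced_socleP T : socle_set G T <-> T \in balanced_socle.
Proof.
rewrite socle_setE inE !cap_full.
have cT := card_bipartition T cG; have le1 := cap_leq V1 T; have le2 := cap_leq V2 T.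
by split=> [[ev st]|st]; lia.
Qed.

Lemma balanced_tau T : T \in balanced_socle -> tau G T = #|V1|.
Proof.
rewrite inE !cap_full => /andP[ev st]; rewrite (tau_complete_bipartite cG) // /max_side.
by have le1 := cap_leq V1 T; have le2 := cap_leq V2 T; lia.
Qed.

(** Inclusion-exclusion: 2^(a-1) even sets contain each side, where a = |V1|, and only V contains
    both. *)
Lemma card_balanced_socle : #|balanced_socle| = 2 ^ #|V1| - 1.
Proof.
have [cov dis _] := cG.
pose D1 := [set T : {set V} | (T :&: V1 == V1) && (odd #|T :&: V2| == odd #|V1|)].
pose D2 := [set T : {set V} | (odd #|T :&: V1| == odd #|V1|) && (T :&: V2 == V2)].
have c1 : #|D1| = 2 ^ #|V1|.-1.
  rewrite [LHS](card_product_bipartition (fun S => S == V1)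
    (fun S => odd #|S| == odd #|V1|) cov dis).
  by rewrite card_full mul1n card_odd_subsets // eq12.
have c2 : #|D2| = 2 ^ #|V1|.-1.
  rewrite [LHS](card_product_bipartition (fun S => odd #|S| == odd #|V1|)
    (fun S => S == V2) cov dis).
  by rewrite card_full muln1 card_odd_subsets.
have cI : #|D1 :&: D2| = 1.
  rewrite (_ : D1 :&: D2 = [set setT]) ?cards1 //; apply/setP=> T; rewrite !inE.
  apply/andP/eqP => [[/andP[/eqP e1 _] /andP[_ /eqP e2]]|->].
    by rewrite -[T]setIT -cov setIUr e1 e2.
  by rewrite !setTI !eqxx eq12 eqxx.
have -> : balanced_socle = D1 :|: D2.
  apply/setP=> T; rewrite !inE !cap_full.
  have cT := card_bipartition T cG; have le1 := cap_leq V1 T; have le2 := cap_leq V2 T.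
  lia.
by rewrite cardsU c1 c2 cI -[in 2 ^ #|V1|](prednK V1_gt0) expnS; lia.
Qed.

Lemma socle_degrees_balanced (K : fieldType) :
  socle_degrees K G (nseq (2 ^ #|V1| - 1) #|V1|).
Proof.
rewrite -card_balanced_socle.
have -> : nseq #|balanced_socle| #|V1| = map (tau G) (enum balanced_socle).
  rewrite cardE -(size_map (tau G)); apply/esym/all_pred1P/allP => _ /mapP[T + ->].
  by rewrite mem_enum => /balanced_tau ->; apply/eqP.
apply: (socle_degrees_tau K (bipartition_complete cG) (enum_uniq _)) => T.
by rewrite mem_enum balanced_socleP.
Qed.

End Balanced.

End SocleSets.

Theorem theorem5p2 (K : fieldType) (V : finType) (G : sgraph V)
    (V1 V2 : {set V}) (a b : nat)
    (ha : 1 <= a) (hb : 1 <= b)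
    (hG : complete_bipartite G V1 V2) (hV1 : #|V1| = a) (hV2 : #|V2| = b) :
  (* The guard 2 * k <= i discards the binomials with negative lower entry. *)
  (forall i : nat,
     has_dim (@homog_part K V G i)
       ((\sum_(0 <= k < i.+1 | 2 * k <= i) 'C(a, i - 2 * k)) *
        (\sum_(0 <= k < i.+1 | 2 * k <= i) 'C(b, i - 2 * k)) -
        (\sum_(1 <= k < i.+1 | 2 * k <= i) 'C(a, i - 2 * k)) *
        (\sum_(1 <= k < i.+1 | 2 * k <= i) 'C(b, i - 2 * k)))) /\
  (forall T : {set V}, ~~ odd #|T| ->
     (socle_set G T <->
      (#|T :&: V1| = maxn #|T :&: V1| #|T :&: V2| -> T :&: V1 = V1) /\
      (#|T :&: V2| = maxn #|T :&: V1| #|T :&: V2| -> T :&: V2 = V2))) /\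
  (a < b ->
     socle_degrees K G
       (nseq (\sum_(1 <= i < a.+1 | 2 * i <= a) 'C(b, a - 2 * i)) a ++
        nseq (\sum_(1 <= i < b.+1 | 2 * i <= b) 'C(a, b - 2 * i)) b)) /\
  (a = b ->
     [/\ level K G,
         socle_degrees K G (nseq (2 ^ a - 1) a)
       & is_type K G (2 ^ a - 1)]).
Proof.
subst a b; have bip := bipartition_complete hG.
split=> [i|]; first by rewrite -(card_tau_eq hG) //; exact: (has_dim_homog_part K bip).
split=> [T ev|]; first exact: socle_set_complete_bipartite.
split=> [lt|eq12]; first exact: socle_degrees_lt.
have sd := socle_degrees_balanced hG ha hb eq12 K.
split=> //.
  apply: (@level_tau _ _ _ _ bip #|V1|) => T /(balanced_socleP hG ha hb eq12).
  exact: (balanced_tau hG ha hb eq12).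
(* The type is the length of the list of socle degrees. *)
by case: sd; rewrite size_nseq => B [basisB _]; exists B.
Qed.
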